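(* For three agents, if one agent has an additive $2$-ratio-bounded cost function and the other two have arbitrary monotone cost functions, then a full tEFX allocation of the chores $[m]$ exists.
   Context: A cost function $C:2^{[m]}\to\mathbb{R}_{\ge0}$ is monotone if $C(S\cup\{c\})\ge C(S)$; additive if $C(S)=\sum_{c\in S}C(\{c\})$; $2$-ratio-bounded if $\max_b C(\{b\})\le 2\min_b C(\{b\})$ with positive single-chore costs. A full allocation $X=(X_1,X_2,X_3)$ (a partition of $[m]$) is tEFX if for all agents $i,j$ and every $c\in X_i$, $C_i(X_i\setminus\{c\})\le C_i(X_j\cup\{c\})$. *)

(* Defs.v *)
From mathcomp Require Import all_boot all_order all_algebra.
Set Implicit Arguments. Unset Strict Implicit. Unset Printing Implicit Defensive.
Import Order.TTheory GRing.Theory Num.Theory.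
Local Open Scope ring_scope.

Section Defs.
Variables (R : realFieldType) (m : nat).

Definition nonneg_cost (C : {set 'I_m} -> R) : Prop := forall S, 0 <= C S.

Definition monotone_cost (C : {set 'I_m} -> R) : Prop :=
  nonneg_cost C /\ forall (S : {set 'I_m}) (c : 'I_m), C S <= C (c |: S).

Definition additive_cost (C : {set 'I_m} -> R) : Prop :=
  forall S : {set 'I_m}, C S = \sum_(c in S) C [set c].

Definition ratio2_bounded (C : {set 'I_m} -> R) : Prop :=
  (forall b : 'I_m, 0 < C [set b]) /\
  (forall b b' : 'I_m, C [set b] <= 2 * C [set b']).

Definition full_allocation (n : nat) (X : 'I_n -> {set 'I_m}) : Prop :=
  (forall i j, i != j -> [disjoint X i & X j]) /\
  (forall c : 'I_m, exists i, c \in X i).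

Definition tEFX (n : nat) (C : 'I_n -> {set 'I_m} -> R) (X : 'I_n -> {set 'I_m}) : Prop :=
  forall (i j : 'I_n) (c : 'I_m), c \in X i ->
    C i (X i :\ c) <= C i (c |: X j).
End Defs.

(* Main.v *)
(** Let [a] be the least single-chore cost of the ratio-bounded agent, so that
    each of its chores costs between [a] and [2a]; it accepts any bundle whose
    cost exceeds no other by more than [2a].  Keep a partition [A], [B], [S] in
    which this agent accepts both [A] and [B] in this strong sense, and one of
    the monotone agents accepts [S].  If the other monotone agent accepts [A]
    or [B], we are done.  Otherwise it rejects both, and one chore can be moved
    to [S] so that [S] becomes a cheapest bundle for it.  If the chore comes
    from the bundle which is already cheaper for the ratio-bounded agent, then
    the balance of [A] and [B] is restored with a chore witnessing that the
    other bundle was rejected.  Since [S] grows, this terminates. *)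
Require Import Defs.
From mathcomp Require Import all_boot all_order all_algebra.
From mathcomp Require Import lra.
Set Implicit Arguments. Unset Strict Implicit. Unset Printing Implicit Defensive.
Import Order.TTheory GRing.Theory Num.Theory.
Local Open Scope ring_scope.

(** Counting memberships puts disjointness and covering into one equation, so permuting the bundles
    is arithmetic. *)
Definition part3 (m : nat) (A B S : {set 'I_m}) : Prop :=
  forall x, ((x \in A) + (x \in B) + (x \in S) = 1)%N.

Definition feasible (R : realFieldType) (m : nat) (C : {set 'I_m} -> R)
    (A B S : {set 'I_m}) : bool :=
  [forall c in A, (C (A :\ c) <= C (c |: B)) && (C (A :\ c) <= C (c |: S))].

(** [C S] has no upper bound: only [A] and [B] are offered to this agent, so [S] may grow freely. *)
Definition balanced (R : realFieldType) (m : nat) (C : {set 'I_m} -> R) (a : R)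
    (A B S : {set 'I_m}) : Prop :=
  [/\ C A <= C B + 2 * a, C B <= C A + 2 * a,
      C A <= C S + 2 * a & C B <= C S + 2 * a].

Lemma part3_swap (m : nat) (A B S : {set 'I_m}) : part3 A B S -> part3 B A S.
Proof. by move=> P x; rewrite -(P x) (addnC (x \in B)). Qed.

Lemma part3_swapr (m : nat) (A B S : {set 'I_m}) : part3 A B S -> part3 A S B.
Proof. by move=> P x; rewrite -(P x) addnAC. Qed.

Lemma part3_notin (m : nat) (A B S : {set 'I_m}) (x : 'I_m) :
  part3 A B S -> x \in A -> (x \notin B) /\ (x \notin S).
Proof. by move=> /(_ x); case: (x \in A); case: (x \in B); case: (x \in S). Qed.

Lemma part3_move (m : nat) (A B S : {set 'I_m}) (c : 'I_m) :
  part3 A B S -> c \in A -> part3 (A :\ c) B (c |: S).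
Proof.
move=> P cA x; have [cB cS] := part3_notin P cA.
rewrite !inE; case: eqP => [->|_] /=; last exact: P.
by rewrite (negbTE cB).
Qed.

Lemma feasibleC (R : realFieldType) (m : nat) (C : {set 'I_m} -> R)
    (A B S : {set 'I_m}) :
  feasible C A B S = feasible C A S B.
Proof. by apply: eq_forallb => c; rewrite andbC. Qed.

Lemma monotone_setD1 (R : realFieldType) (m : nat) (C : {set 'I_m} -> R)
    (S : {set 'I_m}) (c : 'I_m) :
  monotone_cost C -> C (S :\ c) <= C S.
Proof.
move=> [_ mono]; have [cS|cS] := boolP (c \in S).
  by rewrite -[in leRHS](setD1K cS).
have -> // : S :\ c = S.
by apply/setP => x; rewrite !inE; case: eqP => // ->; rewrite (negbTE cS).
Qed.

Lemma cheapest_feasible (R : realFieldType) (m : nat) (C : {set 'I_m} -> R)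
    (A B S : {set 'I_m}) :
  monotone_cost C -> C A <= C B -> C A <= C S -> feasible C A B S.
Proof.
move=> mC AB AS; apply/forall_inP => c _.
have h := monotone_setD1 A c mC.
by rewrite !(le_trans h) // (le_trans _ (mC.2 _ c)).
Qed.

Lemma additive_setD1 (R : realFieldType) (m : nat) (C : {set 'I_m} -> R)
    (S : {set 'I_m}) (c : 'I_m) :
  additive_cost C -> c \in S -> C (S :\ c) = C S - C [set c].
Proof.
move=> aC cS; rewrite (aC S) (aC (S :\ c)) (big_setD1 c cS) /=.
by rewrite [RHS]addrC addKr.
Qed.

Lemma additive_setU1 (R : realFieldType) (m : nat) (C : {set 'I_m} -> R)
    (S : {set 'I_m}) (c : 'I_m) :
  additive_cost C -> c \notin S -> C (c |: S) = C S + C [set c].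
Proof. by move=> aC cS; rewrite (aC S) (aC (c |: S)) big_setU1 //= addrC. Qed.

Lemma additive_monotone (R : realFieldType) (m : nat) (C : {set 'I_m} -> R) :
  additive_cost C -> (forall b, 0 < C [set b]) -> monotone_cost C.
Proof.
move=> aC pos; split=> [S|S c]; first by rewrite aC sumr_ge0 // => b _; apply: ltW.
have [cS|cS] := boolP (c \in S).
  by rewrite (setUidPr _) // sub1set.
by rewrite additive_setU1 // lerDl ltW.
Qed.

(** Deleting [c] lowers one side by at least [a] and adding it raises the other by at least [a],
    which absorbs a gap of [2 * a]. *)
Lemma balanced_feasible (R : realFieldType) (m : nat) (C : {set 'I_m} -> R)
    (a : R) (A B S : {set 'I_m}) :
  additive_cost C -> (forall b, a <= C [set b]) -> part3 A B S ->
  C A <= C B + 2 * a -> C A <= C S + 2 * a -> feasible C A B S.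
Proof.
move=> aC ge_a P AB AS; apply/forall_inP => c cA.
have [cB cS] := part3_notin P cA.
rewrite additive_setD1 // !additive_setU1 //.
by have := ge_a c; move=> ?; apply/andP; split; lra.
Qed.

Lemma infeasible_witness (R : realFieldType) (m : nat) (D : {set 'I_m} -> R)
    (A B S : {set 'I_m}) :
  ~~ feasible D A B S ->
  exists2 c, c \in A & (D (c |: B) < D (A :\ c)) \/ (D (c |: S) < D (A :\ c)).
Proof.
case/forall_inPn => c cA; rewrite negb_and -!ltNge => /orP h.
by exists c.
Qed.

(** The violation cannot be against [B], since [D (A :\ c) <= D A <= D B <= D (c |: B)]. *)
Lemma infeasible_cheaper_witness (R : realFieldType) (m : nat)
    (D : {set 'I_m} -> R) (A B S : {set 'I_m}) :
  monotone_cost D -> D A <= D B -> ~~ feasible D A B S ->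
  exists2 c, c \in A & D (c |: S) < D (A :\ c).
Proof.
move=> mD AB /infeasible_witness[c cA [|h]]; last by exists c.
rewrite ltNge (le_trans (monotone_setD1 A c mD)) //.
exact: le_trans AB (mD.2 _ _).
Qed.

Lemma grow_step (R : realFieldType) (m : nat) (C D : {set 'I_m} -> R) (a : R)
    (A B S : {set 'I_m}) :
  additive_cost C -> (forall b, a <= C [set b] <= 2 * a) -> monotone_cost D ->
  part3 A B S -> balanced C a A B S ->
  ~~ feasible D A B S -> ~~ feasible D B A S ->
  exists A' B' S' : {set 'I_m}, [/\ part3 A' B' S', balanced C a A' B' S',
    D S' <= D A', D S' <= D B' & (#|S| < #|S'|)%N].
Proof.
move=> aC ca mD.
wlog BA : A B / C B <= C A.
  move=> W P bal fA fB; have [/W|/ltW /W] := leP (C B) (C A); first exact.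
  by apply=> //; [exact: part3_swap | case: bal].
move=> P [AB BA2 AS BS] fA fB.
have grow d : d \notin S -> (#|S| < #|d |: S|)%N.
  by move=> dS; rewrite cardsU1 dS.
have [DAB|/ltW DBA] := leP (D A) (D B).
  have [d dA hd] := infeasible_cheaper_witness mD DAB fA.
  have [dB dS] := part3_notin P dA; have /andP[d1 d2] := ca d.
  exists (A :\ d), B, (d |: S); split.
  - exact: part3_move.
  (* [C A - C B] lies in [[0, 2a]] and [d] costs at most [2a], so taking [d] from the dearer bundle
     keeps the gap within [[-2a, 2a]]. *)
  - by split; rewrite ?additive_setU1 ?additive_setD1 //; lra.
  - exact: ltW.
  - by apply: le_trans (ltW hd) (le_trans (monotone_setD1 A d mD) DAB).
  - exact: grow.
have [d dB hd] := infeasible_cheaper_witness mD DBA fB.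
have [dA dS] := part3_notin (part3_swap P) dB; have /andP[d1 d2] := ca d.
have SB : D (d |: S) <= D B := le_trans (ltW hd) (monotone_setD1 B d mD).
(* Now [d] leaves the bundle that is cheaper for [C], and the gap widens to this value. *)
have [small|big] := leP (C A - C B + C [set d]) (2 * a).
  exists A, (B :\ d), (d |: S); split.
  - exact/part3_swap/part3_move/dB/part3_swap.
  - by split; rewrite ?additive_setU1 ?additive_setD1 //; lra.
  - exact: le_trans DBA.
  - exact: ltW.
  - exact: grow.
have [c cA hc] := infeasible_witness fA.
have [cB cS] := part3_notin P cA; have /andP[c1 c2] := ca c.
have cBd : c \notin B :\ d by rewrite !inE (negbTE cB) andbF.
have [DS|DS] := leP (D (d |: S)) (D (A :\ c)).
  exists (A :\ c), (c |: (B :\ d)), (d |: S); split.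
  - have P1 : part3 A (d |: S) (B :\ d).
      exact/part3_swapr/part3_swap/(part3_move (part3_swap P) dB).
    exact/part3_swapr/(part3_move P1 cA).
  (* The new gap is [(C A - C B + C [set d]) - 2 * C [set c]], a value in [(2a, 4a]] minus one in
     [[2a, 4a]]. Against the new [S], [big] and [AS] give [C B < C S + C [set d]]. *)
  - by split; rewrite ?additive_setU1 ?additive_setD1 //; lra.
  - by [].
  - exact: le_trans (ltW hd) (mD.2 _ _).
  - exact: grow.
(* The other alternative would give [D (c |: B) < D (A :\ c) < D (d |: S) <= D B], against
   monotonicity. *)
have {}hc : D (c |: S) < D (A :\ c).
  case: hc => // h; move: (lt_trans h DS).
  by rewrite ltNge (le_trans SB) // mD.2.
exists (A :\ c), B, (c |: S); split.
- exact: part3_move.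
- by split; rewrite ?additive_setU1 ?additive_setD1 //; lra.
- exact: ltW.
- exact: ltW (lt_le_trans (lt_trans hc DS) SB).
- exact: grow.
Qed.

Lemma grow_to_feasible (R : realFieldType) (m : nat)
    (C D E : {set 'I_m} -> R) (a : R) (A B S : {set 'I_m}) :
  additive_cost C -> (forall b, a <= C [set b] <= 2 * a) ->
  monotone_cost D -> monotone_cost E ->
  part3 A B S -> balanced C a A B S -> feasible D S A B ->
  exists A' B' S' : {set 'I_m}, [/\ part3 A' B' S', feasible C A' B' S',
    feasible D B' A' S' & feasible E S' A' B'].
Proof.
move=> aC ca.
have [n] := ubnP (m - #|S|).
elim: n D E A B S => // n IH D E A B S ltn mD mE P bal fD.
have ge_a b : a <= C [set b] by case/andP: (ca b).
case: (bal) => AB BA AS BS.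
have fA : feasible C A B S by apply: balanced_feasible AB AS.
have fB : feasible C B A S by apply: balanced_feasible (part3_swap P) BA BS.
have [fEB|fEB] := boolP (feasible E B A S).
  by exists A, S, B; split=> //; [exact: part3_swapr | rewrite feasibleC].
have [fEA|fEA] := boolP (feasible E A B S).
  exists B, S, A; split=> //; first exact/part3_swapr/part3_swap.
    by rewrite feasibleC.
  by rewrite feasibleC.
have [A' [B' [S' [P' bal' SA' SB' lt']]]] := grow_step aC ca mE P bal fEA fEB.
have lem : (#|S'| <= m)%N by rewrite -[leqRHS]card_ord max_card.
have fE : feasible E S' A' B' by apply: cheapest_feasible.
(* The monotone agents swap roles: [E] now accepts [S'], and [D] is tested on [A'] and [B']. *)
have [|X [Y [Z [PX fX fY fZ]]]] := IH E D A' B' S' _ mE mD P' bal' fE.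
  exact: leq_trans (ltn_sub2l (leq_trans lt' lem) lt') ltn.
by exists X, Z, Y; split=> //; [exact: part3_swapr | rewrite feasibleC].
Qed.

(** Greedy: each chore, costing at most [2a], joins a cheapest bundle, and the name [S] passes to
    the new cheapest one. All pairwise gaps are then at most [2a], so any of the three bundles can
    start as the growing one. *)
Lemma balanced_partition (R : realFieldType) (m : nat) (C : {set 'I_m} -> R)
    (a : R) (U : {set 'I_m}) :
  additive_cost C -> 0 <= a -> (forall b, a <= C [set b] <= 2 * a) ->
  exists A B S : {set 'I_m},
    [/\ forall x, ((x \in A) + (x \in B) + (x \in S) = (x \in U))%N,
        C S <= C A <= C S + 2 * a & C S <= C B <= C S + 2 * a].
Proof.
move=> aC a0 ca; have [n] := ubnP #|U|; elim: n U => // n IH U ltn.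
have [->|[c cU]] := set_0Vmem U.
  by exists set0, set0, set0; split=> [x||]; rewrite ?inE //; apply/andP; split; lra.
have [|A [B [S [P /andP[SA AS] /andP[SB BS]]]]] := IH (U :\ c).
  by move: ltn; rewrite (cardsD1 c U) cU.
have [cA cB cS] : [/\ c \notin A, c \notin B & c \notin S].
  by move: (P c); rewrite !inE eqxx; do 3!case: (c \in _).
have P1 x : ((x \in A) + (x \in B) + (x \in c |: S) = (x \in U))%N.
  move: (P x); rewrite !inE; case: eqP => //= ->.
  by rewrite cU (negbTE cA) (negbTE cB).
have C1 := additive_setU1 aC cS; have /andP[c1 c2] := ca c.
have [AB|BA] := leP (C A) (C B).
  have [AS'|S'A] := leP (C A) (C (c |: S)).
    exists (c |: S), B, A; split; try by apply/andP; split; lra.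
    by move=> x; rewrite -P1 addnC addnA addnAC.
  by exists A, B, (c |: S); split=> //; apply/andP; split; lra.
have [BS'|S'B] := leP (C B) (C (c |: S)).
  exists A, (c |: S), B; split; try by apply/andP; split; lra.
  by move=> x; rewrite -P1 addnAC.
by exists A, B, (c |: S); split=> //; apply/andP; split; lra.
Qed.

Lemma ratio2_bounded_scale (R : realFieldType) (m : nat)
    (C : {set 'I_m} -> R) :
  ratio2_bounded C -> exists2 a, 0 <= a & forall b, a <= C [set b] <= 2 * a.
Proof.
move=> [pos ratio]; case: m C pos ratio => [|m] C pos ratio.
  (* Without chores there is no minimum to take, and any nonnegative scale serves. *)
  by exists 0 => // -[].
pose b0 := [arg min_(b < ord0) C [set b]]%O.
have min_b0 b : C [set b0] <= C [set b].
  by rewrite /b0; case: arg_minP => // i _; apply.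
by exists (C [set b0]) => [|b]; [exact: ltW | rewrite min_b0 ratio].
Qed.

Lemma three_feasible (R : realFieldType) (m : nat) (C D E : {set 'I_m} -> R) :
  additive_cost C -> ratio2_bounded C -> monotone_cost D -> monotone_cost E ->
  exists A B S : {set 'I_m}, [/\ part3 A B S, feasible C A B S,
    feasible D B A S & feasible E S A B].
Proof.
move=> aC rC mD mE; have [a a0 ca] := ratio2_bounded_scale rC.
have [A [B [S [P /andP[SA AS] /andP[SB BS]]]]] :=
  balanced_partition [set: 'I_m] aC a0 ca.
have {}P : part3 A B S by move=> x; rewrite P inE.
have grown X Y Z : part3 X Y Z -> balanced C a X Y Z ->
    D Z <= D X -> D Z <= D Y -> exists A B S : {set 'I_m},
      [/\ part3 A B S, feasible C A B S, feasible D B A S & feasible E S A B].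
  move=> PZ bal ZX ZY.
  by apply: (grow_to_feasible aC ca mD mE PZ bal); apply: cheapest_feasible.
(* The bundle cheapest for [D] takes the role of [S]. *)
have [DAB|/ltW DBA] := leP (D A) (D B).
  have [DAS|/ltW DSA] := leP (D A) (D S).
    by apply: (grown S B A) => //; [exact/part3_swapr/part3_swap/part3_swapr
      | split; lra].
  by apply: (grown A B S) => //; [split; lra | exact: le_trans DAB].
have [DBS|/ltW DSB] := leP (D B) (D S).
  by apply: (grown A S B) => //; [exact: part3_swapr | split; lra].
by apply: (grown A B S) => //; [split; lra | exact: le_trans DBA].
Qed.

Theorem theorem3 (R : realFieldType) (m : nat) (C : 'I_3 -> {set 'I_m} -> R)
  (i0 : 'I_3) :
  additive_cost (C i0) -> ratio2_bounded (C i0) ->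
  (forall i, i != i0 -> monotone_cost (C i)) ->
  exists X : 'I_3 -> {set 'I_m}, full_allocation X /\ tEFX C X.
Proof.
move=> aC rC mC.
have mC0 : monotone_cost (C i0) := additive_monotone aC rC.1.
have mono i : monotone_cost (C i) by have [->//|/mC] := eqVneq i i0.
have [j [k [ji ki kj cover]]] : exists j k : 'I_3,
    [/\ j != i0, k != i0, k != j & forall i, [|| i == i0, i == j | i == k]].
  (* Addition in ['I_3] is modulo 3, so these are the two other agents. *)
  exists (i0 + 1), (i0 + 2%:R); split; last first.
    by move=> i; case: i i0 {aC rC mC mC0} => [[|[|[|]]]] // ? [[|[|[|]]]].
  1-3: by case: i0 {aC rC mC mC0} => [[|[|[|]]]].
have [A [B [S [P fA fB fS]]]] := three_feasible aC rC (mono j) (mono k).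
pose X i := if i == i0 then A else if i == j then B else S.
have Xi0 : X i0 = A by rewrite /X eqxx.
have Xj : X j = B by rewrite /X (negbTE ji) eqxx.
have Xk : X k = S by rewrite /X (negbTE ki) (negbTE kj).
exists X; split; first split.
- move=> i l il; rewrite -setI_eq0; apply/eqP/setP => x; rewrite !inE.
  move: (P x) il; case/or3P: (cover i) => /eqP->;
    case/or3P: (cover l) => /eqP->; rewrite ?Xi0 ?Xj ?Xk ?eqxx //;
    by case: (x \in A); case: (x \in B); case: (x \in S).
- move=> c; move: (P c); have [cA|cA] := boolP (c \in A).
    by exists i0; rewrite Xi0.
  have [cB|cB] := boolP (c \in B); first by exists j; rewrite Xj.
  by case: (boolP (c \in S)) => // cS _; exists k; rewrite Xk.
(* tEFX also compares an agent with itself; monotonicity settles that case. *)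
move=> i l c; have self : C i (X i :\ c) <= C i (c |: X i).
  exact: le_trans (monotone_setD1 _ _ (mono i)) ((mono i).2 _ _).
move: self; case/or3P: (cover i) => /eqP->; case/or3P: (cover l) => /eqP->;
  rewrite ?Xi0 ?Xj ?Xk // => _ cX.
- by case/andP: (forall_inP fA c cX).
- by case/andP: (forall_inP fA c cX).
- by case/andP: (forall_inP fB c cX).
- by case/andP: (forall_inP fB c cX).
- by case/andP: (forall_inP fS c cX).
- by case/andP: (forall_inP fS c cX).
Qed.
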